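(* For each integer $\Delta\ge 2$ and each odd integer $d>0$ there exist a non-negative matrix $A\in\mathbb{Z}_{\ge 0}^{15d\times(15d+6)}$ with $\lVert A\rVert_\infty=\Delta$ and a right-hand side $b\in\mathbb{Z}_{\ge 0}^{15d}$ such that $\mathrm{prox}(A,b)\ge\Delta^{\Theta(d)}$. Furthermore, the underlying ILP is polytopish.
   Context: For $x\in\mathbb{R}^n$ and $Y\subseteq\mathbb{R}^n$ let $\mathrm{dist}(x,Y)=\min_{y\in Y}\lVert x-y\rVert_\infty$, and for $X,Y\subseteq\mathbb{R}^n$ let $\mathrm{dist}(X,Y)=\max_{x\in X}\mathrm{dist}(x,Y)$. For $A\in\mathbb{Z}^{m\times n}$ of full row rank, $b\in\mathbb{Z}^m$ and objective $c\in\mathbb{Z}^n$, let $\mathrm{IntSol}(A,b,c)$ be the set of optimal solutions of $\min\{c^\top x: Ax=b, x\in\mathbb{Z}^n_{\ge0}\}$ and $\mathrm{FracSol}(A,b,c)$ the set of optimal solutions of $\min\{c^\top z: Az=b, z\in\mathbb{Q}^n_{\ge0}\}$. The proximity is $\mathrm{prox}(A,b,c)=\mathrm{dist}(\mathrm{FracSol}(A,b,c),\mathrm{IntSol}(A,b,c))$, and $\mathrm{prox}(A,b)$ denotes this quantity with the zero objective $c=0$. $\Delta$ denotes $\lVert A\rVert_\infty$, the largest absolute value of an entry of $A$. ''$\ge\Delta^{\Theta(d)}$'' means at least $\Delta^{\gamma d}$ for an absolute constant $\gamma>0$ independent of $\Delta$ and $d$. An ILP $\min\{c^\top x: Ax=b,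 x\in\mathbb{Z}^n_{\ge0}\}$ is called polytopish if there is a polytope $\mathcal{P}$ such that the columns of $A$ are exactly the integer points of $\mathcal{P}$ (each appearing once). *)

(* Defs.v *)
From HB Require Import structures.
From mathcomp Require Export all_boot all_order all_algebra.
From mathcomp Require Export all_classical all_reals all_analysis.
Export Order.TTheory GRing.Theory Num.Theory.
Export numFieldNormedType.Exports.

Set Implicit Arguments.
Unset Strict Implicit.
Unset Printing Implicit Defensive.

Local Open Scope classical_set_scope.
Local Open Scope ring_scope.

Section Programs.
Variables (K : numDomainType) (m n : nat).
Implicit Types (A : 'M[K]_(m, n)) (b : 'cV[K]_m) (c x : 'cV[K]_n).

Definition feasible A b : set 'cV[K]_n :=
  [set x | A *m x = b /\ forall j, 0 <= x j 0].

Definition opt_sol A b c : set 'cV[K]_n :=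
  [set x | feasible A b x /\
    forall y, feasible A b y -> (c^T *m x) 0 0 <= (c^T *m y) 0 0].

End Programs.

Definition IntSol m n (A : 'M[int]_(m, n)) (b : 'cV[int]_m) (c : 'cV[int]_n) :
  set 'cV[int]_n := opt_sol A b c.

Definition FracSol m n (A : 'M[int]_(m, n)) (b : 'cV[int]_m) (c : 'cV[int]_n) :
  set 'cV[rat]_n := opt_sol (map_mx intr A) (map_mx intr b) (map_mx intr c).

Definition full_row_rank m n (A : 'M[int]_(m, n)) : bool :=
  row_free (map_mx intr A : 'M[rat]_(m, n)).

Section Distances.
Variable R : realType.

(* The norm `|_| of a matrix type is the largest absolute value of an entry.
   Minima and maxima are rendered as extended-real infima and suprema; in
   particular the distance to the empty set is +oo. *)
Definition dist_pt n (x : 'cV[R]_n) (Y : set 'cV[R]_n) : \bar R :=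
  ereal_inf [set `|x - y|%:E | y in Y].

Definition dist n (X Y : set 'cV[R]_n) : \bar R :=
  ereal_sup [set dist_pt x Y | x in X].

(* Meaningful only when IntSol A b c is nonempty. *)
Definition prox m n (A : 'M[int]_(m, n)) (b : 'cV[int]_m) (c : 'cV[int]_n) :
    \bar R :=
  dist (map_mx ratr @` FracSol A b c) (map_mx intr @` IntSol A b c).

(* Convex hull of the columns of V. *)
Definition conv_cols m k (V : 'M[R]_(m, k)) : set 'cV[R]_m :=
  [set V *m l | l in
     [set l : 'cV[R]_k | (forall i, 0 <= l i 0) /\ \sum_i l i 0 = 1]].

Definition polytope m (P : set 'cV[R]_m) : Prop :=
  exists (k : nat) (V : 'M[R]_(m, k)), P = conv_cols V.

(* The columns of A list the integer points of some polytope, each exactly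
   once; this depends on the constraint matrix of the ILP only. *)
Definition polytopish m n (A : 'M[int]_(m, n)) : Prop :=
  exists P : set 'cV[R]_m,
    [/\ polytope P,
        forall v : 'cV[int]_m, P (map_mx intr v) <-> exists j, v = col j A &
        injective (fun j : 'I_n => col j A)].

End Distances.

(* Main.v *)
(* With B_i = Delta^(i+1), the equations Delta x_i + y_i = B_i and
   x_(i+1) + y_i = B_i force x_(i+1) = Delta x_i, hence
   x_(5d) = Delta^(5d) x_0.  Adding x_(i+1) + t_i = B_i, every value of x_0 in
   [0, 1] extends to a feasible point; x_0 = 1/2 is then at distance at least
   Delta^(5d) / 2 >= Delta^d from every integer solution.

   Delta occurs only in the first row of each of the 5d triples.  An integer
   point of the convex hull of the columns has coordinates 0 or 1 in the other
   rows, hence is there a vertex of the cube; as the columns are pairwise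
   distinct on these rows, the point is a column. *)
Require Import Defs.
From mathcomp Require Import zify lra.

Set Implicit Arguments.
Unset Strict Implicit.
Unset Printing Implicit Defensive.

Local Open Scope classical_set_scope.
Local Open Scope ring_scope.

Lemma le_mx_entry_norm (K : realDomainType) m n (x : 'M[K]_(m, n)) i j :
  `|x i j| <= `|x|.
Proof.
rewrite /Num.norm /= mx_normrE.
apply: (@le_bigmax _ _ _ _ (fun ij : 'I_m * 'I_n => `|x ij.1 ij.2|) (i, j)).
Qed.

(* Row k of triple i, with w = 15d.  Columns 3i, 3i+1, 3i+2 carry x_i, y_i, t_i
   and column w carries x_(5d).  The five columns w+1+e have entry 1 in the last
   row of every triple but the e-th; they only bring the number of columns to
   15d+6 and do not touch the equations that force x_(i+1) = Delta x_i. *)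
Definition chain_entry (D w i k c : nat) : nat :=
  (if k == 0%N then D * (c == 3 * i) + (c == 3 * i + 1)
   else if k == 1%N then (c == 3 * i + 3) + (c == 3 * i + 1)
   else (c == 3 * i + 3) + (c == 3 * i + 2) + ((w < c) && (c - w.+1 != i)))%N.

Definition chain_mx (K : nzRingType) (D d : nat) : 'M[K]_((15 * d)%N, (15 * d + 6)%N) :=
  \matrix_(p, c) (chain_entry D (15 * d) (p %/ 3)%N (p %% 3)%N c)%:R.

(** * Columns on the 0/1 rows, and integer points of their convex hull *)

Lemma chain_entry_le1 D d i k c : (k < 3)%N -> k != 0%N -> (i < 5 * d)%N ->
  (chain_entry D (15 * d)%N i k c <= 1)%N.
Proof.
by move=> k3 k0 id5; rewrite /chain_entry; case: k k3 k0 => [|[|[|//]]] //=; lia.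
Qed.

Lemma chain_entry_inj D d c c' : (0 < d)%N -> (c < 15 * d + 6)%N -> (c' < 15 * d + 6)%N ->
  (forall i k, (i < 5 * d)%N -> (0 < k < 3)%N ->
    chain_entry D (15 * d)%N i k c = chain_entry D (15 * d)%N i k c') -> c = c'.
Proof.
move=> d0; wlog ltcc : c c' / (c < c')%N => [th cd cd' E|cd cd' E].
  case: (ltngtP c c') => [lt|lt|//]; first exact: th.
  by apply/esym/th => // i k id k3; rewrite E.
have E1 i (H : (i < 5 * d)%N) := E i 1%N H isT.
have E2 i (H : (i < 5 * d)%N) := E i 2%N H isT.
rewrite /chain_entry /= in E1 E2; clear E.
have [cw'|cw'] := leqP c' (15 * d)%N; last first.
  have d5 : (15 * d >= 15)%N by lia.
  have [cw|cw] := leqP c (15 * d)%N.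
    (* Column [c'] has a 1 in the last row of at least two of the triples 0, 1, 2; column [c] has
       one in at most one triple. *)
    have lc i : (i < 5)%N -> (c' - (15 * d).+1 != i)%N -> (3 * i + 1 < c < 3 * i + 4)%N.
      move=> i5 ci; have := E2 i ltac:(lia).
      by rewrite cw' ci ltnNge cw /= addn0; case: eqP; case: eqP; lia.
    have := lc 0%N isT; have := lc 1%N isT; have := lc 2%N isT.
    by case: (c' - _)%N => [|[|n]] /=; lia.
  (* Both are padding columns: [c] vanishes in the last row of the triple it skips, [c'] does
     not. *)
  have := E2 (c - (15 * d).+1)%N ltac:(lia).
  rewrite cw cw' eqxx /=.
  lia.
(* Possible since [c'] exceeds [c] and so is positive. Columns 3i+1, 3i+2, 3i+3 read (1,0), (0,1),
   (1,1) in the last two rows of triple i, where all other columns up to 15d vanish. *)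
have [i [r [r3 Ec']]] : exists i r, (r < 3)%N /\ c' = (3 * i + r.+1)%N.
  by exists ((c' - 1) %/ 3)%N, ((c' - 1) %% 3)%N; lia.
subst c'; have id : (i < 5 * d)%N by lia.
have cw := leq_trans (ltnW ltcc) cw'.
have := E1 i id; have := E2 i id; rewrite !ltnNge cw cw' /=; clear -r3 ltcc.
by case: r r3 ltcc => [|[|[|//]]] _; do 4 case: eqP => ? //=; lia.
Qed.

Lemma sum_pick (K : pzRingType) n (f : nat -> K) k : (k < n)%N ->
  \sum_(j < n) (j == k :> nat)%:R * f j = f k.
Proof.
move=> kn; rewrite (bigD1 (Ordinal kn)) //= eqxx mul1r big1 ?addr0 // => j jk.
by rewrite (_ : (_ == _) = false) ?mul0r //; apply/negbTE.
Qed.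

(** On a row in [Z], a convex combination of 0/1 entries is an integer only if all columns of
    positive weight agree there. Columns that agree on [Z] are equal, so a single column carries the
    whole weight. *)
Lemma polytopish_01 (R : realType) m n (A : 'M[int]_(m, n)) (Z : pred 'I_m) :
  (forall p c, Z p -> (A p c == 0) || (A p c == 1)) ->
  (forall c c', (forall p, Z p -> A p c = A p c') -> c = c') ->
  polytopish R A.
Proof.
move=> A01 Ainj.
exists (conv_cols (map_mx intr A : 'M[R]_(m, n))); split.
- by exists n, (map_mx intr A).
- move=> v; split; last first.
    move=> [j ->]; exists (delta_mx j 0); last by rewrite map_col colE.
    split=> [i|]; first by rewrite mxE; case: andP.
    rewrite (bigD1 j) //= mxE !eqxx big1 ?addr0 // => i ij.
    by rewrite mxE (negbTE ij).
  move=> [l [l0 l1] lv].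
  have [j lj] : exists j, 0 < l j 0.
    apply: contrapT => /forallNP H.
    move: l1; rewrite big1 => [/esym/eqP|i _]; first by rewrite oner_eq0.
    by apply/eqP; rewrite eq_le l0 andbT leNgt; apply/negP/H.
  have vE p : (v p 0)%:~R = \sum_i (A p i)%:~R * l i 0 :> R.
    move/matrixP/(_ p 0): lv; rewrite !mxE => <-.
    by apply: eq_bigr => i _; rewrite mxE.
  have B p i : Z p -> 0 <= (A p i)%:~R * l i 0 <= l i 0.
    by move=> Zp; case/orP: (A01 p i Zp) => /eqP ->;
      rewrite ?mul0r ?mul1r ?lexx ?l0.
  have E p c : Z p -> 0 < l c 0 -> v p 0 = A p c.
    move=> Zp lc.
    have le1 : (v p 0)%:~R <= 1 :> R.
      by rewrite vE -[leRHS]l1; apply: ler_sum => i _; case/andP: (B p i Zp).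
    have ge0 : 0 <= (v p 0)%:~R :> R.
      by rewrite vE; apply: sumr_ge0 => i _; case/andP: (B p i Zp).
    rewrite lerz1 in le1; rewrite ler0z in ge0.
    case/orP: (A01 p c Zp) => /eqP Apc; rewrite Apc.
    - suff : (v p 0)%:~R < 1 :> R by rewrite ltrz1; lia.
      rewrite vE -[ltRHS]l1 (bigD1 c) //= [ltRHS](bigD1 c) //= Apc mul0r ltr_leD //.
      by apply: ler_sum => i _; case/andP: (B p i Zp).
    - suff : 0 < (v p 0)%:~R :> R by rewrite ltr0z; lia.
      rewrite vE (bigD1 c) //= Apc mul1r ltr_wpDr //; by apply: sumr_ge0 => i _; case/andP: (B p i Zp).
  have lE i : i != j -> l i 0 = 0.
    move=> ij; apply/eqP; rewrite eq_le l0 andbT leNgt; apply/negP => li.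
    by case/eqP: ij; apply: Ainj => p Zp; rewrite -(E p i) // -(E p j).
  have lj1 : l j 0 = 1.
    by rewrite -l1 (bigD1 j) //= big1 ?addr0.
  exists j; apply/matrixP => p q; rewrite (ord1 q) [RHS]mxE.
  apply: (@intr_inj R); rewrite vE (bigD1 j) //= lj1 mulr1 big1 ?addr0 // => i ij.
  by rewrite lE ?mulr0.
- move=> c c' /= /matrixP E; apply: Ainj => p _.
  by have := E p 0; rewrite !mxE.
Qed.


(** * The chain equations: solvability, growth and feasible points *)

Lemma chain_mx_row (K : nzRingType) D d (f : nat -> K) (p : 'I_(15 * d)) :
  let i := (p %/ 3)%N in
  (chain_mx K D d *m \col_j f j) p 0 =
    if (p %% 3 == 0)%N then D%:R * f (3 * i)%N + f (3 * i + 1)%N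
    else if (p %% 3 == 1)%N then f (3 * i + 3)%N + f (3 * i + 1)%N
    else f (3 * i + 3)%N + f (3 * i + 2)%N +
         \sum_(j < 15 * d + 6) ((15 * d < j) && (j - (15 * d).+1 != i))%N%:R * f j.
Proof.
have pd := ltn_ord p.
move=> i; rewrite mxE; under eq_bigr do rewrite !mxE /chain_entry -/i.
case: ifP => _; last case: ifP => _.
- under eq_bigr do rewrite natrD natrM mulrDl -mulrA.
  rewrite big_split -mulr_sumr /= !sum_pick //; rewrite /i; lia.
- under eq_bigr do rewrite natrD mulrDl.
  rewrite big_split /= !sum_pick //; rewrite /i; lia.
under eq_bigr do rewrite !natrD !mulrDl.
by rewrite !big_split /= !sum_pick //; rewrite /i; lia.
Qed.

(** Padding variables are 0, so they drop out of the third equations; position 15d still carries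
    x_(5d). *)
Definition chain_seq (K : nzRingType) d (x y t : nat -> K) (j : nat) : K :=
  if (15 * d < j)%N then 0
  else nth 0 [:: x (j %/ 3)%N; y (j %/ 3)%N; t (j %/ 3)%N] (j %% 3)%N.

Lemma chain_mx_col (K : nzRingType) D d (x y t v : nat -> K) :
  (forall i, (i < 5 * d)%N ->
    [/\ D%:R * x i + y i = v (3 * i)%N, x i.+1 + y i = v (3 * i + 1)%N
      & x i.+1 + t i = v (3 * i + 2)%N]) ->
  chain_mx K D d *m (\col_j chain_seq d x y t j) = \col_p v p.
Proof.
move=> H; apply/matrixP => p q; rewrite (ord1 q) {q}.
rewrite chain_mx_row [RHS]mxE /chain_seq.
have pd := ltn_ord p.
have id : (p %/ 3 < 5 * d)%N by lia.
have [H0 H1 H2] := H _ id.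
set i := (p %/ 3)%N in id H0 H1 H2 *.
have lt k : (k < 4)%N -> (15 * d < 3 * i + k)%N = false by lia.
have E k : (k < 3)%N -> ((3 * i + k) %/ 3 = i)%N /\ ((3 * i + k) %% 3 = k)%N by lia.
have [E0d E0m] := E 0%N isT; have [E1d E1m] := E 1%N isT; have [E2d E2m] := E 2%N isT.
rewrite addn0 in E0d E0m; have := lt 0%N isT; rewrite addn0 => l0.
have -> : (3 * i + 3 = 3 * i.+1)%N by lia.
have l3 : (15 * d < 3 * i.+1)%N = false by lia.
have [E3d E3m] : (3 * i.+1 %/ 3 = i.+1)%N /\ (3 * i.+1 %% 3 = 0)%N by lia.
rewrite l0 l3 !lt // E0d E0m E1d E1m E2d E2m E3d E3m /=.
have pE : (p = 3 * i + p %% 3 :> nat)%N by rewrite /i; lia.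
case: ifP => [/eqP p0|/eqP p0]; first by rewrite H0 pE p0 addn0.
case: ifP => [/eqP p1|/eqP p1]; first by rewrite H1 pE p1.
rewrite H2 big1 ?addr0 => [|j _]; first by congr v; lia.
by case: ltnP => _; rewrite /= ?mulr0 ?mul0r.
Qed.

(** Forward substitution from x_0 = 0: the three equations of a triple give y_i, x_(i+1) and t_i in
    turn. Solving for the unit vectors then yields a right inverse, hence full row rank. *)
Lemma chain_mx_solvable (K : nzRingType) D d (v : nat -> K) :
  exists u, chain_mx K D d *m u = \col_p v p.
Proof.
pose x := fix x i := if i is i.+1 then
  v (3 * i + 1)%N - (v (3 * i)%N - D%:R * x i) else 0.
exists (\col_j chain_seq d x (fun i => v (3 * i)%N - D%:R * x i)
  (fun i => v (3 * i + 2)%N - x i.+1) j).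
by apply: chain_mx_col => i _; split; rewrite ?subrK // addrC subrK.
Qed.

Lemma chain_mx_free (K : fieldType) D d : row_free (chain_mx K D d).
Proof.
apply/row_freeP.
have sol (k : 'I_(15 * d)) : exists u, chain_mx K D d *m u = \col_p (p == k :> nat)%:R.
  exact: (chain_mx_solvable D d (fun p => (p == k)%:R)).
have [g gE] := choice sol.
exists (\matrix_(j, k) g k j 0); apply/matrixP => p k.
have /matrixP/(_ p 0) := gE k; rewrite !mxE -val_eqE => <-.
by apply: eq_bigr => j _; rewrite !mxE.
Qed.

Lemma chain_growth (K : nzRingType) D d (f : nat -> K) :
  chain_mx K D d *m \col_j f j = \col_p (D ^ (p %/ 3).+1)%:R ->
  f (15 * d)%N = (D ^ (5 * d))%:R * f 0%N.
Proof.
move=> /matrixP E.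
have step i : (i < 5 * d)%N -> f (3 * i.+1)%N = D%:R * f (3 * i)%N.
  move=> id.
  have p0 : (3 * i < 15 * d)%N by lia.
  have p1 : (3 * i + 1 < 15 * d)%N by lia.
  have := E (Ordinal p0) 0; have := E (Ordinal p1) 0.
  rewrite !chain_mx_row !mxE /=.
  have [-> ->] : ((3 * i + 1) %/ 3 = i)%N /\ ((3 * i + 1) %% 3 = 1)%N by lia.
  have [-> ->] : ((3 * i) %/ 3 = i)%N /\ ((3 * i) %% 3 = 0)%N by lia.
  (* Both rows have the same right-hand side, and y_i cancels. *)
  rewrite /= => <- /addIr ->; congr f; lia.
have all i : (i <= 5 * d)%N -> f (3 * i)%N = (D ^ i)%:R * f 0%N.
  elim: i => [|i IH] id; first by rewrite muln0 expn0 mul1r.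
  by rewrite step // IH ?(ltnW id) // expnS natrM mulrA.
by rewrite -all //; congr f; lia.
Qed.

(** Used with a = 0 for an integer solution and with a = 1/2 for the distant fractional one. *)
Lemma chain_feasible (K : numDomainType) D d (a : K) : 0 <= a <= 1 ->
  feasible (chain_mx K D d) (\col_p (D ^ (p %/ 3).+1)%:R)
    (\col_j chain_seq d (fun i => (D ^ i)%:R * a) (fun i => (D ^ i.+1)%:R * (1 - a))
                      (fun i => (D ^ i.+1)%:R * (1 - a)) j).
Proof.
move=> /andP[a0 a1]; split.
  apply: (chain_mx_col (v := fun p => (D ^ (p %/ 3).+1)%:R)) => i _ /=.
  have [-> -> ->] : [/\ 3 * i %/ 3 = i, (3 * i + 1) %/ 3 = i & (3 * i + 2) %/ 3 = i]%N
    by split; lia.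
  by split; rewrite ?mulrA -?natrM -?expnS -mulrDr (addrC a) subrK mulr1.
move=> j; rewrite mxE /chain_seq; case: ifP => // _.
have : (j %% 3 < 3)%N by rewrite ltn_mod.
by case: (j %% 3)%N => [|[|[|]]] //= _; rewrite mulr_ge0 ?ler0n ?subr_ge0.
Qed.

(** * Norm and polytopish property of the chain matrix *)

Lemma norm_chain_mx D d : (0 < D)%N -> (0 < d)%N -> `|chain_mx int D d| = D%:Z.
Proof.
move=> D0 d0; apply/eqP; rewrite eq_le; apply/andP; split.
  have [<-//|] := eqVneq 0 `|chain_mx int D d|.
  rewrite eq_sym => /mx_norm_neq0[[p c] /= nE].
  rewrite [leLHS]nE mxE ger0_norm ?ler0n // natz lez_nat.
  have [k0|k0] := eqVneq (p %% 3)%N 0%N.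
    (* The entries [D] and 1 of a first row lie in different columns, so they never add up. *)
    rewrite /chain_entry k0 /=; case: eqP => [->|_]; case: eqP; lia.
  apply: leq_trans D0; apply: chain_entry_le1 => //; rewrite ?ltn_mod //.
  by have := ltn_ord p; lia.
have p0 : (0 < 15 * d)%N by lia.
have c0 : (0 < 15 * d + 6)%N by lia.
have := le_mx_entry_norm (chain_mx int D d) (Ordinal p0) (Ordinal c0).
by apply: le_trans; rewrite mxE /chain_entry /= muln1 addn0 natz.
Qed.

Lemma polytopish_chain_mx (R : realType) D d : (0 < d)%N ->
  polytopish R (chain_mx int D d).
Proof.
move=> d0; apply: (@polytopish_01 _ _ _ _ (fun p => p %% 3 != 0)%N) => [p c p0|c c' E].
  rewrite mxE; have pd := ltn_ord p.
  have := @chain_entry_le1 D d (p %/ 3) (p %% 3) c ltac:(lia) p0 ltac:(lia).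
  by case: (chain_entry _ _ _ _ _) => [|[|n]].
apply/val_inj/(chain_entry_inj (D := D) d0 (ltn_ord c) (ltn_ord c')) => i k id k3.
have pd : (3 * i + k < 15 * d)%N by lia.
have [dE mE] : ((3 * i + k) %/ 3 = i)%N /\ ((3 * i + k) %% 3 = k)%N by lia.
have := E (Ordinal pd); rewrite !mxE /= dE mE => /(_ ltac:(lia)).
by rewrite !natz => -[].
Qed.

(** * The distance bound *)

Lemma half_far (R : realType) (k : int) : 2^-1 <= `|2^-1 - k%:~R| :> R.
Proof.
have [k0|k0] := lerP k 0.
  have k0R : k%:~R <= 0 :> R by rewrite lerz0.
  by rewrite ger0_norm; lra.
have k0R : 1 <= k%:~R :> R by rewrite ler1z; lia.
by rewrite ler0_norm; lra.
Qed.

Theorem theorem2 (R : realType) :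
  exists gamma : R, 0 < gamma /\
    forall Delta d : nat, (2 <= Delta)%N -> (0 < d)%N -> odd d ->
      exists (A : 'M[int]_(15 * d, 15 * d + 6)) (b : 'cV[int]_(15 * d)),
        (forall i j, 0 <= A i j) /\
        (forall i, 0 <= b i 0) /\
        `|A| = Delta%:Z /\
        full_row_rank A /\
        IntSol A b 0 !=set0 /\
        ((Delta%:R `^ (gamma * d%:R))%:E <= prox R A b 0)%E /\
        polytopish R A.
Proof.
exists 1; split=> // D d D2 d0 _.
pose b (K : nzRingType) : 'cV[K]_(15 * d) := \col_p (D ^ (p %/ 3).+1)%:R.
have mapA : map_mx intr (chain_mx int D d) = chain_mx rat D d.
  by apply/matrixP => p c; rewrite !mxE rmorph_nat.
have mapb : map_mx intr (b int) = b rat.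
  by apply/matrixP => p c; rewrite !mxE rmorph_nat.
exists (chain_mx int D d), (b int); split; first by move=> i j; rewrite mxE ler0n.
split; first by move=> i; rewrite mxE ler0n.
split; first by apply: norm_chain_mx; lia.
split; first by rewrite /full_row_rank mapA chain_mx_free.
split.
  eexists; split; first by apply: (@chain_feasible _ _ _ 0); rewrite lexx ler01.
  by move=> y _; rewrite trmx0 !mul0mx.
split; last exact: polytopish_chain_mx.
rewrite mul1r powR_mulrn ?ler0n // /prox /dist.
pose z : 'cV[rat]_(15 * d + 6) := \col_j chain_seq d (fun i => (D ^ i)%:R * (2^-1 : rat))
  (fun i => (D ^ i.+1)%:R * (1 - 2^-1)) (fun i => (D ^ i.+1)%:R * (1 - 2^-1)) j.
apply: (@le_trans _ _ (dist_pt (map_mx ratr z)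
  (map_mx intr @` IntSol (chain_mx int D d) (b int) 0))); last first.
  apply: ereal_sup_ubound; exists (map_mx ratr z) => //; exists z => //.
  rewrite /FracSol mapA mapb map_mx0; split; first by apply: chain_feasible; lra.
  by move=> y _; rewrite trmx0 !mul0mx.
apply: le_ereal_inf_tmp => _ [_ [u [[Au _] _]] <-] <-.
rewrite lee_fin.
(* Extends [u] by 0 to all naturals, the form that [chain_growth] expects. *)
pose f j := oapp (u ^~ 0) 0 (insub j).
have uE : u = \col_j f j.
  by apply/matrixP => j k; rewrite (ord1 k) mxE /f valK.
have fN : f (15 * d)%N = (D ^ (5 * d))%:R * f 0%N.
  by apply: chain_growth; rewrite -uE.
have j0 : (15 * d < 15 * d + 6)%N by lia.
(* Only coordinate 15d, which carries x_(5d), is compared. *)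
apply: (le_trans _ (le_mx_entry_norm _ (Ordinal j0) 0)).
rewrite uE !mxE /= fN /chain_seq ltnn.
have [-> ->] : ((15 * d) %/ 3 = 5 * d)%N /\ ((15 * d) %% 3 = 0)%N by lia.
rewrite /= rmorphM fmorphV intrM !rmorph_nat -mulrBr normrM
   ger0_norm ?ler0n //.
apply: (@le_trans _ _ ((D ^ (5 * d))%:R * 2^-1)); last first.
  by rewrite ler_wpM2l ?ler0n ?half_far.
rewrite ler_pdivlMr ?ltr0n // -natrX -natrM ler_nat.
(* The spare factor [D ^ (4 * d)] is at least 2 and absorbs the 1/2, so the exponent constant 1
   suffices. *)
have -> : (5 * d = d + 4 * d)%N by lia.
rewrite expnD leq_mul2l.
have d4 : (1 <= 4 * d)%N by lia.
by rewrite (leq_trans D2 (leq_pexp2l (ltnW D2) d4)) orbT.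
Qed.
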